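(* Let $\lambda,\mu\in\mathbb{R}$, let $\omega$ be the EPR state of $\mathfrak{A}[\mathbb{R}^{2}]\otimes\mathfrak{A}[\mathbb{R}^{2}]$ with parameters $\lambda,\mu$, and let $(\pi,\mathcal{H},\Omega)$ be its GNS representation. Let $\mathfrak{R}=\pi(\mathfrak{A}[\mathbb{R}^{2}]\otimes I)''$, let $\mathfrak{R}'$ be the commutant of $\mathfrak{R}$ in $\mathbf{B}(\mathcal{H})$, and let $\rho$ be the state of $\mathbf{B}(\mathcal{H})$ given by $\rho(X)=\langle\Omega,X\Omega\rangle$. Then $\mathfrak{R}'=\pi(I\otimes\mathfrak{A}[\mathbb{R}^{2}])''$, and every observable $A=A^{*}\in\mathfrak{R}$ has a unique double in $\mathfrak{R}'$ relative to $\rho$; that is, there is a unique $A'=A'^{*}\in\mathfrak{R}'$ such that $\rho((A-A')^{2})=0$.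
   Context: The Weyl algebra $\mathfrak{A}[\mathbb{R}^{2}]$ is the $C^{*}$-algebra generated by unitary operators $W(\mathbf{a})$, $\mathbf{a}\in\mathbb{R}^{2}$, satisfying the Weyl relations $W(\mathbf{a})W(\mathbf{b})=\exp\{i\sigma(\mathbf{a},\mathbf{b})\}\,W(\mathbf{a}+\mathbf{b})$, where $\sigma((a,b),(a',b'))=\tfrac12(ab'-ba')$. (This $C^{*}$-algebra is simple, and it is determined up to isomorphism by these relations.) The tensor product $\otimes$ of $C^{*}$-algebras is the spatial (minimal) one. A state of a $C^{*}$-algebra is a positive, normalized linear functional. $\mathbf{B}(\mathcal{H})$ denotes the bounded operators on $\mathcal{H}$, and $''$ denotes the double commutant. The EPR state with parameters $\lambda,\mu\in\mathbb{R}$ is the unique state $\omega$ of $\mathfrak{A}[\mathbb{R}^{2}]\otimes\mathfrak{A}[\mathbb{R}^{2}]$ such that $\omega(W(a,0)\otimes W(-a,0))=e^{ia\lambda}$ and $\omega(W(0,b)\otimes W(0,b))=e^{ib\mu}$ for all $a,b\in\mathbb{R}$. On Weyl operators it is given by $\omega(W(a,b)\otimes W(c,d))=e^{ia\lambda}e^{ib\mu}$ if $c=-a$ and $d=b$, and $0$ otherwise. For a von Neumann algebra $\mathfrak{R}$ with commutant $\mathfrak{R}'$ and a state $\rho$, a double of an observable (self-adjoint element) $A\in\mathfrak{R}$ relative to $\rho$ is an observable $A'\in\mathfrak{R}'$ such that $\rho((A-A')^{2})=0$. *)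

(* Defs.v *)
From HB Require Import structures.
From mathcomp Require Import all_boot all_order all_algebra.
From mathcomp Require Import complex.
From mathcomp Require Import all_classical all_reals all_analysis.

Set Implicit Arguments.
Unset Strict Implicit.
Unset Printing Implicit Defensive.

Import Order.TTheory GRing.Theory Num.Theory.
Import numFieldNormedType.Exports.

Local Open Scope classical_set_scope.
Local Open Scope complex_scope.
Local Open Scope ring_scope.

(* Nonzero unital C*-algebras over the complex numbers R[i]. The norm of a
   normed module over R[i] takes its values in the nonnegative reals of R[i].
   The product is a field of the mixin, and not that of a GRing.Algebra,
   because the hierarchy lacks a join of (semi)rings with normed Z-modules. *)
HB.mixin Record CompleteNormedModule_isCStar (R : realType) A
    of CompleteNormedModule R[i] A := {
  cmul : A -> A -> A ;
  cone : A ;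
  star : A -> A ;
  cmulA : forall x y z, cmul x (cmul y z) = cmul (cmul x y) z ;
  cmul1l : forall x, cmul cone x = x ;
  cmul1r : forall x, cmul x cone = x ;
  cmul_linearl : forall (a : R[i]) x y z,
    cmul (a *: x + y) z = a *: cmul x z + cmul y z ;
  cmul_linearr : forall (a : R[i]) x y z,
    cmul x (a *: y + z) = a *: cmul x y + cmul x z ;
  cone_neq0 : cone != 0 ;
  star_antilinear : forall (a : R[i]) x y,
    star (a *: x + y) = a^* *: star x + star y ;
  star_cmul : forall x y, star (cmul x y) = cmul (star y) (star x) ;
  starK : involutive star ;
  norm_cmul_le : forall x y, `|cmul x y| <= `|x| * `|y| ;
  norm_star_cmul : forall x, `|cmul (star x) x| = `|x| ^+ 2
}.

#[short(type="cstarAlgType")]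
HB.structure Definition CStarAlgebra (R : realType) :=
  {A of CompleteNormedModule_isCStar R A & CompleteNormedModule R[i] A}.

Notation "x ∙ y" := (cmul x y) (at level 40, left associativity) : ring_scope.
Notation "𝟙" := cone : ring_scope.

(* The inner product is antilinear in its first argument. *)
HB.mixin Record CompleteNormedModule_isHilbert (R : realType) H
    of CompleteNormedModule R[i] H := {
  ip : H -> H -> R[i] ;
  ip_linearr : forall (a : R[i]) (x y z : H),
    ip x (a *: y + z) = a * ip x y + ip x z ;
  ip_conj : forall x y : H, ip y x = (ip x y)^* ;
  ip_norm : forall x : H, ip x x = `|x| ^+ 2
}.

#[short(type="hilbertType")]
HB.structure Definition Hilbert (R : realType) :=
  {H of CompleteNormedModule_isHilbert R H & CompleteNormedModule R[i] H}.

Section CStar.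
Variable R : realType.

Definition cstar_subalgebra (A : cstarAlgType R) (B : set A) : Prop :=
  [/\ B 𝟙,
      forall (a : R[i]) x y, B x -> B y -> B (a *: x + y),
      forall x y, B x -> B y -> B (x ∙ y),
      forall x, B x -> B (star x)
    & closed B].

Definition cstar_generated (A : cstarAlgType R) (S : set A) : set A :=
  smallest (@cstar_subalgebra A) S.

Definition unitary (A : cstarAlgType R) (u : A) : Prop :=
  star u ∙ u = 𝟙 /\ u ∙ star u = 𝟙.

Definition is_state (A : cstarAlgType R) (omega : {scalar A}) : Prop :=
  (forall x : A, 0 <= omega (star x ∙ x)) /\ omega 𝟙 = 1.

End CStar.

Section Operators.
Variables (R : realType) (H : hilbertType R).

Definition bounded_operator (X : H -> H) : Prop :=
  (forall (a : R[i]) x y, X (a *: x + y) = a *: X x + X y) /\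
  (exists M : R[i], forall x, `|X x| <= M * `|x|).

Definition self_adjoint (X : H -> H) : Prop :=
  forall x y, ip (X x) y = ip x (X y).

Definition commutant (S : set (H -> H)) : set (H -> H) :=
  [set X | bounded_operator X /\ forall Y, S Y -> X \o Y = Y \o X].

Definition bicommutant (S : set (H -> H)) : set (H -> H) :=
  commutant (commutant S).

Definition closed_subspace (V : set H) : Prop :=
  [/\ V 0, forall (a : R[i]) x y, V x -> V y -> V (a *: x + y) & closed V].

Definition vector_state (v : H) (X : H -> H) : R[i] := ip v (X v).

Definition is_double (N : set (H -> H)) (rho : (H -> H) -> R[i])
    (A A' : H -> H) : Prop :=
  [/\ commutant N A', self_adjoint A' & rho ((A \- A') \o (A \- A')) = 0].

End Operators.

Section Representations.
Variables (R : realType) (A : cstarAlgType R).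

Definition representation (H : hilbertType R) (pi : A -> H -> H) : Prop :=
  (forall x, bounded_operator (pi x)) /\
  [/\ forall (a : R[i]) x y v, pi (a *: x + y) v = a *: pi x v + pi y v,
      forall x y, pi (x ∙ y) = pi x \o pi y,
      pi 𝟙 = id
    & forall x u v, ip (pi x u) v = ip u (pi (star x) v)].

Definition faithful (H : hilbertType R) (pi : A -> H -> H) : Prop :=
  representation pi /\ injective pi.

Definition is_GNS (omega : {scalar A}) (H : hilbertType R)
    (pi : A -> H -> H) (Omega : H) : Prop :=
  [/\ representation pi,
      closure [set pi x Omega | x in [set: A]] = [set: H]
    & forall x, omega x = ip Omega (pi x Omega)].

End Representations.

(* (K, t) is the Hilbert space tensor product of H1 and H2. *)
Definition is_hilbert_tensor (R : realType) (H1 H2 K : hilbertType R)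
    (t : H1 -> H2 -> K) : Prop :=
  [/\ forall (a : R[i]) x x' y, t (a *: x + x') y = a *: t x y + t x' y,
      forall (a : R[i]) x y y', t x (a *: y + y') = a *: t x y + t x y',
      forall x x' y y', ip (t x y) (t x' y') = ip x x' * ip y y'
    & smallest (@closed_subspace R K) [set t x y | x in setT & y in setT]
      = setT].

(* (T, tens) is the spatial tensor product of A and B: T is the C*-algebra
   generated by the elementary tensors, with the usual algebraic operations, and
   its norm is the operator norm on a Hilbert space tensor product: the
   assignment of pi1 a (x) pi2 b to tens a b extends to a faithful, hence
   isometric, representation Pi of T, for faithful representations pi1 of A and
   pi2 of B. The resulting norm does not depend on the choice of pi1 and pi2. *)
Definition is_spatial_tensor (R : realType) (A B T : cstarAlgType R)
    (tens : A -> B -> T) : Prop :=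
  [/\ forall (a : R[i]) x x' y,
        tens (a *: x + x') y = a *: tens x y + tens x' y,
      forall (a : R[i]) x y y',
        tens x (a *: y + y') = a *: tens x y + tens x y',
      forall x x' y y', tens x y ∙ tens x' y' = tens (x ∙ x') (y ∙ y'),
      forall x y, star (tens x y) = tens (star x) (star y)
    & tens 𝟙 𝟙 = 𝟙] /\
  cstar_generated [set tens x y | x in setT & y in setT] = setT /\
  exists (H1 H2 K : hilbertType R) (t : H1 -> H2 -> K)
         (pi1 : A -> H1 -> H1) (pi2 : B -> H2 -> H2) (Pi : T -> K -> K),
    [/\ is_hilbert_tensor t, faithful pi1, faithful pi2, faithful Pi
      & forall x y u v, Pi (tens x y) (t u v) = t (pi1 x u) (pi2 y v)].

Section Weyl.
Variable R : realType.

Definition expi (x : R) : R[i] := cos x +i* sin x.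

Definition weyl_sigma (u v : R * R) : R := (u.1 * v.2 - u.2 * v.1) / 2.

Definition is_weyl_algebra (A : cstarAlgType R) (W : R * R -> A) : Prop :=
  [/\ forall u, unitary (W u),
      forall u v, W u ∙ W v = expi (weyl_sigma u v) *: W (u + v)
    & cstar_generated (range W) = setT].

Definition is_EPR_state (A T : cstarAlgType R) (W : R * R -> A)
    (tens : A -> A -> T) (lambda mu : R) (omega : {scalar T}) : Prop :=
  [/\ is_state omega,
      forall a, omega (tens (W (a, 0)) (W (- a, 0))) = expi (a * lambda)
    & forall b, omega (tens (W (0, b)) (W (0, b))) = expi (b * mu)].

End Weyl.

(* Main.v *)
Require Import Defs.
From mathcomp Require Import all_boot all_order all_algebra.
From mathcomp Require Import complex ring lra.
From mathcomp Require Import all_classical all_reals all_analysis.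

Import Order.TTheory GRing.Theory Num.Theory.
Import numFieldNormedType.Exports.

Local Open Scope classical_set_scope.
Local Open Scope ring_scope.

(** Each Weyl operator has a mirror: the EPR correlations, being of modulus one,
    make [Omega] an eigenvector of the correlated Weyl operators of the two
    factors, so every [W u] acts on [Omega] in the first factor as some [y] does
    in the second. Since the two factors commute, [Omega] is a trace vector for
    the first one, and [x Omega |-> x^* Omega] extends to an antiunitary
    involution [J]. The identity [<Omega, Z v> = <J v, Z Omega>] holds both for
    [Z] in the commutant of the first factor and for [Z] in the commutant of
    the second one, which makes these commutants commute with each other. The
    double of [X] is [J X J]; it is unique because [Omega] is cyclic.
    The passage from Weyl operators to C*-algebras uses that representations
    are contractive, which is proved from the Neumann series. *)

(** * Real-valued norms and completeness *)

Section Norm.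
Context {R : realType}.

(** The norm of a normed module over [R[i]] is complex-valued; its real part makes estimates in the
    ordered field [R] possible. *)
Definition nrm {V : normedZmodType R[i]} (x : V) : R := complex.Re `|x|.

Section Generic.
Context {V : normedZmodType R[i]}.
Implicit Types x y : V.

Lemma normE x : `|x| = (nrm x)%:C%C.
Proof. by rewrite /nrm RRe_real // normr_real. Qed.

Lemma nrm_ge0 x : 0 <= nrm x.
Proof. by rewrite -ler0c -normE normr_ge0. Qed.

Lemma nrm0 : nrm (0 : V) = 0.
Proof. by rewrite /nrm normr0. Qed.

Lemma nrmN x : nrm (- x) = nrm x.
Proof. by rewrite /nrm normrN. Qed.

Lemma nrm_sub x y : nrm (x - y) = nrm (y - x).
Proof. by rewrite /nrm distrC. Qed.

Lemma nrmD x y : nrm (x + y) <= nrm x + nrm y.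
Proof. by rewrite -lecR rmorphD /= -!normE ler_normD. Qed.

Lemma nrmB_trans y x z : nrm (x - z) <= nrm (x - y) + nrm (y - z).
Proof. by have := nrmD (x - y) (y - z); rewrite addrA subrK. Qed.

Lemma nrm_eq0 x : nrm x = 0 -> x = 0.
Proof. by move=> x0; apply/eqP; rewrite -normr_eq0 normE x0. Qed.

Lemma nrm_le_eps x : (forall e : R, 0 < e -> nrm x <= e) -> x = 0.
Proof.
move=> xe; apply: nrm_eq0; apply/eqP; rewrite eq_le nrm_ge0 andbT.
by apply/ler_addgt0Pr => e e0; rewrite add0r xe.
Qed.

End Generic.

Lemma nrmZ (V : normedModType R[i]) (a : R[i]) (x : V) : nrm (a *: x) = nrm a * nrm x.
Proof. by apply: complexI; rewrite rmorphM /= -!normE normrZ. Qed.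

Lemma nrm_real (a : R) : nrm (a%:C%C) = `|a|.
Proof. by rewrite /nrm normc_def /= expr0n addr0 sqrtr_sqr. Qed.

(** Completeness without a choice of sequences: the sets [F e] generate a Cauchy filter. The limit
    [l] itself need not lie in any [F e]. *)
Lemma shrinking_limit (V : completeNormedModType R[i]) (F : R -> set V) (C : R) :
  (forall e, 0 < e -> exists x, F e x) ->
  (forall e e', e <= e' -> F e `<=` F e') ->
  (forall e, 0 < e -> forall x y, F e x -> F e y -> nrm (x - y) <= C * e) ->
  exists l, forall e, 0 < e -> exists2 x, F e x & nrm (x - l) < e.
Proof.
move=> Fne Fmono Fdiam.
pose G := filter_from [set e : R | 0 < e] F.
have GF : Filter G.
  apply: filter_from_filter; first by exists 1; rewrite /= ltr01.
  move=> i j /= i0 j0; exists (Num.min i j); first by rewrite /= lt_min i0.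
  by move=> x Fx; split; apply: Fmono Fx; rewrite ge_min lexx ?orbT.
have PG : ProperFilter G.
  by apply: filter_from_proper => i /= /Fne [x Fx]; exists x.
have cG : cauchy G.
  apply: cauchy_exP => e; rewrite ltcE => /andP[/eqP /= e1 e0].
  have eE : e = (complex.Re e)%:C%C by case: e e1 e0 => a b /= ->.
  (* The absolute value of [C] plus one keeps the denominator positive whatever the sign of [C]; the
     factor 2 makes the ball inequality strict. *)
  pose d := complex.Re e / (2 * (`|C| + 1)).
  have d0 : 0 < d by rewrite divr_gt0 // mulr_gt0 // ltr_wpDl.
  have [x Fx] := Fne _ d0.
  exists x, d => // y Fy; rewrite -ball_normE /= normE eE ltcR.
  apply: le_lt_trans (Fdiam _ d0 _ _ Fx Fy) _.
  have : C * d <= (`|C| + 1) * d by rewrite ler_pM2r //; have := ler_norm C; lra.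
  have : (`|C| + 1) * d = complex.Re e / 2.
    by rewrite /d; field; rewrite gt_eqF // ltr_wpDl.
  by move: e0; lra.
have Gl := @cauchy_cvg _ G PG cG; set l := lim G in Gl.
exists l => e e0.
have lt_eC : 0 < e%:C%C :> R[i] by rewrite ltcR.
have /= := Gl _ (nbhsx_ballx l _ lt_eC).
case=> d d0 Fd.
(* Below both radii, monotonicity puts one and the same point in [F e] and in the ball around
   [l]. *)
have m0 : 0 < Num.min d e by rewrite lt_min d0.
have [x Fx] := Fne _ m0.
exists x; first by apply: Fmono Fx; rewrite ge_min lexx orbT.
have /Fd : F d x by apply: Fmono Fx; rewrite ge_min lexx.
by rewrite -ball_normE /= normE ltcR nrm_sub.
Qed.
End Norm.

(** * Hilbert spaces and C*-algebras *)

Section HilbertSpace.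
Context {R : realType} {H : hilbertType R}.
Implicit Types (x y z : H) (a : R[i]).

Lemma ip0r x : ip x 0 = 0.
Proof.
have := ip_linearr 1 x 0 0; rewrite scale1r addr0 mul1r => /esym/eqP.
by rewrite -subr_eq0 addrK => /eqP.
Qed.

Lemma ipDr x y z : ip x (y + z) = ip x y + ip x z.
Proof. by rewrite -[y]scale1r ip_linearr mul1r scale1r. Qed.

Lemma ipZr a x y : ip x (a *: y) = a * ip x y.
Proof. by rewrite -[a *: y]addr0 ip_linearr ip0r addr0. Qed.

Lemma ipBr x y z : ip x (y - z) = ip x y - ip x z.
Proof. by rewrite ipDr -scaleN1r ipZr mulN1r. Qed.

Lemma ipDl x y z : ip (x + y) z = ip x z + ip y z.
Proof. by rewrite ip_conj ipDr rmorphD /= -!ip_conj. Qed.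

Lemma ipBl x y z : ip (x - y) z = ip x z - ip y z.
Proof. by rewrite ip_conj ipBr rmorphB /= -!ip_conj. Qed.

Lemma ipZl a x y : ip (a *: x) y = a^* * ip x y.
Proof. by rewrite ip_conj ipZr rmorphM /= -ip_conj. Qed.

Lemma ip_nrm x : ip x x = (nrm x ^+ 2)%:C%C.
Proof. by rewrite ip_norm normE rmorphXn. Qed.

Lemma ip_eqP x y : (forall z, ip x z = ip y z) -> x = y.
Proof.
move=> xy; apply/eqP; rewrite -subr_eq0; apply/eqP/nrm_eq0.
have : ip (x - y) (x - y) = 0 by rewrite ipBl xy subrr.
by rewrite ip_nrm => /complexI/eqP; rewrite sqrf_eq0 => /eqP.
Qed.

Lemma sqr_nrm a : (nrm a ^+ 2)%:C%C = a * a^* :> R[i].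
Proof. by rewrite -normCK normE rmorphXn. Qed.

Lemma cauchy_schwarz x y : nrm (ip x y) <= nrm x * nrm y.
Proof.
have [/eqP y0|y0] := boolP (nrm y == 0).
  by rewrite (nrm_eq0 _ y0) ip0r !nrm0 mulr0.
have yp : 0 < nrm y by rewrite lt_def y0 nrm_ge0.
set c := ip x y; set n := nrm y ^+ 2.
have np : 0 < n by rewrite exprn_gt0.
(* [z] is [n] times the component of [x] orthogonal to [y]; the factor [n] avoids a division. *)
pose z := n%:C%C *: x - c^* *: y.
have : ip z z = (n * (n * nrm x ^+ 2 - nrm c ^+ 2))%:C%C.
  rewrite /z ipBl !ipBr !ipZl !ipZr [ip y x]ip_conj -/c conjCK.
  rewrite (_ : (n%:C%C)^* = n%:C%C); last exact: conjc_real.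
  have -> (p q : R) : (n * (n * p - q))%:C%C = n%:C%C * (n%:C%C * p%:C%C - q%:C%C) :> R[i].
    by rewrite !(rmorphM, rmorphB).
  by rewrite sqr_nrm (ip_nrm x) (ip_nrm y) -/n -/c; ring.
rewrite ip_nrm => /complexI zE.
have : 0 <= n * (n * nrm x ^+ 2 - nrm c ^+ 2) by rewrite -zE sqr_ge0.
rewrite pmulr_rge0 // subr_ge0 /n -exprMn mulrC.
by rewrite ler_sqr // nnegrE ?mulr_ge0 ?nrm_ge0.
Qed.

(** The bound in [bounded_operator] is a complex number; a positive real one can be divided by. *)
Lemma bounded_operator_nrm (X : H -> H) : bounded_operator X ->
  exists2 M : R, 0 < M & forall x, nrm (X x) <= M * nrm x.
Proof.
move=> [_ [M bM]]; exists (nrm M + 1); first by rewrite ltr_wpDl ?nrm_ge0.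
move=> x; have := bM x => h.
have h2 : `|X x| <= `|M * `|x| |.
  by apply: le_trans h _; rewrite real_ler_norm // ger0_real // (le_trans _ (bM x)).
rewrite normrM normr_id !normE -rmorphM /= lecR in h2.
by apply: le_trans h2 _; rewrite ler_wpM2r ?nrm_ge0 // lerDl.
Qed.

Lemma bounded_operator_intro (X : H -> H) (M : R) :
  (forall a x y, X (a *: x + y) = a *: X x + X y) ->
  (forall x, nrm (X x) <= M * nrm x) -> bounded_operator X.
Proof.
move=> linX bX; split=> //; exists M%:C%C => x.
by rewrite !normE -rmorphM /= lecR.
Qed.

Section BoundedOperator.
Context {X : H -> H} (bX : bounded_operator X).

Lemma opD x y : X (x + y) = X x + X y.
Proof. by have := bX.1 1 x y; rewrite !scale1r. Qed.

Lemma op0 : X 0 = 0.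
Proof. by have /eqP := opD 0 0; rewrite addr0 -subr_eq0 opprD addNKr oppr_eq0 => /eqP. Qed.

Lemma opZ a x : X (a *: x) = a *: X x.
Proof. by have := bX.1 a x 0; rewrite !addr0 op0 addr0. Qed.

Lemma opB x y : X (x - y) = X x - X y.
Proof. by rewrite opD -scaleN1r opZ scaleN1r. Qed.

End BoundedOperator.

Lemma bounded_operator_comp (X Y : H -> H) :
  bounded_operator X -> bounded_operator Y -> bounded_operator (X \o Y).
Proof.
move=> bX bY; have [M M0 hM] := bounded_operator_nrm _ bX.
have [N N0 hN] := bounded_operator_nrm _ bY.
apply: (@bounded_operator_intro _ (M * N)) => [a x y /=|x /=].
  by rewrite (opD bY) (opZ bY) (opD bX) (opZ bX).
by rewrite (le_trans (hM _)) // -mulrA ler_pM2l.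
Qed.

Lemma commutant_ge (S S' : set (H -> H)) :
  S `<=` S' -> commutant S' `<=` commutant S.
Proof. by move=> SS' X [bX cX]; split=> // Y /SS'; apply: cX. Qed.

Lemma sub_bicommutant (S : set (H -> H)) :
  (forall X, S X -> bounded_operator X) -> S `<=` bicommutant S.
Proof. by move=> bS X SX; split=> [|Y [_ cY]]; [exact: bS | rewrite cY]. Qed.

Lemma commutant_bicommutant (S : set (H -> H)) :
  (forall X, S X -> bounded_operator X) ->
  commutant (bicommutant S) = commutant S.
Proof.
move=> bS; apply/seteqP; split; first exact: commutant_ge (sub_bicommutant _ bS).
by apply: sub_bicommutant => X [].
Qed.

End HilbertSpace.

Section CStarAlgebra.
Context {R : realType} {A : cstarAlgType R}.
Implicit Types (x y z : A) (a : R[i]).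

Lemma cmulDl x y z : (x + y) ∙ z = x ∙ z + y ∙ z.
Proof. by have := cmul_linearl 1 x y z; rewrite !scale1r. Qed.

Lemma cmulDr x y z : x ∙ (y + z) = x ∙ y + x ∙ z.
Proof. by have := cmul_linearr 1 x y z; rewrite !scale1r. Qed.

Lemma cmul0l x : 0 ∙ x = 0.
Proof. by have /eqP := cmulDl 0 0 x; rewrite addr0 -subr_eq0 opprD addNKr oppr_eq0 => /eqP. Qed.

Lemma cmul0r x : x ∙ 0 = 0.
Proof. by have /eqP := cmulDr x 0 0; rewrite addr0 -subr_eq0 opprD addNKr oppr_eq0 => /eqP. Qed.

Lemma cmulZl a x y : (a *: x) ∙ y = a *: (x ∙ y).
Proof. by rewrite -[a *: x]addr0 cmul_linearl cmul0l addr0. Qed.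

Lemma cmulZr a x y : x ∙ (a *: y) = a *: (x ∙ y).
Proof. by rewrite -[a *: y]addr0 cmul_linearr cmul0r addr0. Qed.

Lemma cmulBl x y z : (x - y) ∙ z = x ∙ z - y ∙ z.
Proof. by rewrite cmulDl -scaleN1r cmulZl scaleN1r. Qed.

Lemma cmulBr x y z : x ∙ (y - z) = x ∙ y - x ∙ z.
Proof. by rewrite cmulDr -scaleN1r cmulZr scaleN1r. Qed.

Lemma starD x y : star (x + y) = star x + star y.
Proof. by have := star_antilinear 1 x y; rewrite rmorph1 !scale1r. Qed.

Lemma star0 : star (0 : A) = 0.
Proof. by have /eqP := starD 0 0; rewrite addr0 -subr_eq0 opprD addNKr oppr_eq0 => /eqP. Qed.

Lemma starZ a x : star (a *: x) = a^* *: star x.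
Proof. by rewrite -[a *: x]addr0 star_antilinear star0 addr0. Qed.

Lemma starB x y : star (x - y) = star x - star y.
Proof. by rewrite starD -scaleN1r starZ rmorphN1 scaleN1r. Qed.

Lemma star1 : star (𝟙 : A) = 𝟙.
Proof. by rewrite -[RHS]starK -[star 𝟙 in RHS]cmul1r star_cmul starK cmul1r. Qed.

Lemma nrm_cmul x y : nrm (x ∙ y) <= nrm x * nrm y.
Proof. by have := norm_cmul_le x y; rewrite !normE -rmorphM /= lecR. Qed.

Lemma nrm_star_cmul x : nrm (star x ∙ x) = nrm x ^+ 2.
Proof. by have := norm_star_cmul x; rewrite !normE -rmorphXn /= => /complexI. Qed.

(** The C*-identity bounds the square of [nrm z] by [nrm (star z) * nrm z]; cancel [nrm z], then
    exchange the roles of [z] and [star z]. *)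
Lemma nrm_star x : nrm (star x) = nrm x.
Proof.
suff le_star z : nrm z <= nrm (star z).
  by apply/le_anti; rewrite le_star -[x in X in _ <= X]starK le_star.
have [->|z0] := eqVneq z 0; first by rewrite nrm0 nrm_ge0.
have zp : 0 < nrm z.
  by rewrite lt_def nrm_ge0 andbT; apply: contraNneq z0 => /nrm_eq0 ->.
by rewrite -(ler_pM2r zp) -expr2 -nrm_star_cmul nrm_cmul.
Qed.

Lemma exists_expr_lt (r e : R) : 0 <= r -> r < 1 -> 0 < e -> exists n, r ^+ n < e.
Proof.
move=> r0 r1 e0.
have /cvgrPdist_lt /(_ _ e0) [n _ /(_ n (leqnn n)) /=] : (r ^+ n @[n --> \oo] --> (0 : R)).
  by apply: cvg_expr; rewrite ger0_norm.
by rewrite sub0r normrN ger0_norm ?exprn_ge0 // => ?; exists n.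
Qed.

(** The partial sums of the Neumann series are the iterates of [z |-> z + res z] from 0, and each
    iteration multiplies the residual by [w]. Two approximate left inverses with residuals at most
    [e] differ by at most [2 * e / (1 - r)], so [shrinking_limit] yields the inverse. *)
Lemma neumann_left_inverse (w : A) : nrm w < 1 -> exists z, z ∙ (𝟙 - w) = 𝟙.
Proof.
set r := nrm w => r1; have r0 : 0 <= r by exact: nrm_ge0.
pose res z := 𝟙 - z ∙ (𝟙 - w).
pose F (e : R) := [set z | nrm (res z) <= e].
have [||e e0 x y Fx Fy|l Fl] := @shrinking_limit _ A F (2 / (1 - r)).
- move=> e e0.
  (* The iteration starts with residual [𝟙], hence its norm in the denominator; adding 1 gives
     positivity. *)
  have e'0 : 0 < e / (nrm (𝟙 : A) + 1) by rewrite divr_gt0 // ltr_wpDl ?nrm_ge0.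
  have [n rn] := exists_expr_lt _ _ r0 r1 e'0.
  have [z hz] : exists z, nrm (res z) <= r ^+ n * nrm (𝟙 : A).
    elim: {rn}n => [|n [z hz]].
      by exists 0; rewrite /res cmul0l subr0 mul1r.
    exists (z + res z).
    have -> : res (z + res z) = res z ∙ w.
      by rewrite {1}/res cmulDl opprD addrA -/(res z) cmulBr cmul1r opprB addrC subrK.
    by rewrite exprSr mulrAC (le_trans (nrm_cmul _ _)) // ler_wpM2r.
  exists z; rewrite /F /=; apply: le_trans hz _.
  rewrite ltr_pdivlMr ?ltr_wpDl ?nrm_ge0 // in rn.
  apply: le_trans (ltW rn); rewrite ler_wpM2l ?exprn_ge0 //; lra.
- by move=> e e' ee' z; rewrite /F /= => /le_trans; apply.
- have dE : x - y = (x - y) ∙ w + (res y - res x).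
    have -> : res y - res x = (x - y) ∙ (𝟙 - w).
      by rewrite /res opprB addrC addrA subrK cmulBl.
    by rewrite -cmulDr [w + _]addrC subrK cmul1r.
  have : nrm (x - y) <= nrm (x - y) * r + (e + e).
    rewrite {1}dE; apply: le_trans (nrmD _ _) _; apply: lerD; first exact: nrm_cmul.
    by apply: le_trans (nrmD _ _) _; rewrite nrmN lerD.
  rewrite mulrAC ler_pdivlMr ?subr_gt0 //; lra.
exists l; apply/eqP; rewrite eq_sym -subr_eq0; apply/eqP.
set K := nrm (𝟙 - w); have K0 : 0 <= K by exact: nrm_ge0.
apply: nrm_le_eps => e e0.
have [|x Fx xl] := Fl (e / (1 + K)); first by rewrite divr_gt0 // ltr_pwDl.
have -> : 𝟙 - l ∙ (𝟙 - w) = res x + (x - l) ∙ (𝟙 - w).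
  by rewrite /res cmulBl addrA subrK.
apply: le_trans (nrmD _ _) _.
apply: le_trans (lerD Fx (le_trans (nrm_cmul _ _) (ler_wpM2r K0 (ltW xl)))) _.
by rewrite -[X in X + _]mulr1 -mulrDr divfK // gt_eqF // ltr_pwDl.
Qed.

End CStarAlgebra.

(** * Representations are contractive *)

Section Closure.
Context {R : realType}.

Lemma closure_approx (V : normedModType R[i]) (S : set V) (x : V) :
  closure S x -> forall e : R, 0 < e -> exists2 y, S y & nrm (x - y) < e.
Proof.
move=> clS e e0; have eC : 0 < e%:C%C :> R[i] by rewrite ltcR.
have [y [Sy]] := clS _ (nbhsx_ballx x _ eC).
by rewrite -ball_normE /= normE ltcR => xy; exists y.
Qed.

(** [Q] need not be stable under [star]: the elements [x] such that both [x] and [star x] satisfy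
    [Q] form a C*-subalgebra. *)
Lemma cstar_generated_ind (A : cstarAlgType R) (S Q : set A) :
  Q 𝟙 ->
  (forall (a : R[i]) x y, Q x -> Q y -> Q (a *: x + y)) ->
  (forall x y, Q x -> Q y -> Q (x ∙ y)) ->
  (forall x, (forall e, 0 < e -> exists2 y, Q y & nrm (x - y) < e) -> Q x) ->
  (forall s, S s -> Q s /\ Q (star s)) ->
  cstar_generated S `<=` Q.
Proof.
move=> Q1 Qlin Qmul Qcl SQ x /(_ [set x | Q x /\ Q (star x)]) [] //; split=> //.
split=> /=; first by rewrite star1.
- move=> a y z [Qy Qy'] [Qz Qz']; split; first exact: Qlin.
  by rewrite star_antilinear; apply: Qlin.
- move=> y z [Qy Qy'] [Qz Qz']; split; first exact: Qmul.
  by rewrite star_cmul; apply: Qmul.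
- by move=> y [Qy Qy']; split=> //; rewrite starK.
move=> y /closure_approx yQ; split; apply: Qcl => e /yQ [z [Qz Qz'] yz].
  by exists z.
by exists (star z) => //; rewrite -starB nrm_star.
Qed.

End Closure.

Section Representation.
Context {R : realType} {A : cstarAlgType R} {H : hilbertType R}.
Context {rho : A -> H -> H} (hrho : representation rho).
Implicit Types (x y : A) (u v : H).

Lemma rep_bounded x : bounded_operator (rho x).
Proof. exact: hrho.1. Qed.

Lemma rep_lin (a : R[i]) x y v : rho (a *: x + y) v = a *: rho x v + rho y v.
Proof. by case: hrho.2. Qed.

Lemma rep_mul x y v : rho (x ∙ y) v = rho x (rho y v).
Proof. by case: hrho.2 => _ -> _ _. Qed.

Lemma rep1 v : rho 𝟙 v = v.
Proof. by case: hrho.2 => _ _ -> _. Qed.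

Lemma rep_adj x u v : ip (rho x u) v = ip u (rho (star x) v).
Proof. by case: hrho.2. Qed.

Lemma rep_adjr x u v : ip u (rho x v) = ip (rho (star x) u) v.
Proof. by rewrite rep_adj starK. Qed.

Lemma repB x y v : rho (x - y) v = rho x v - rho y v.
Proof. by rewrite addrC -scaleN1r rep_lin scaleN1r addrC. Qed.

Lemma rep0 v : rho 0 v = 0.
Proof. by rewrite -(subrr (𝟙 : A)) repB subrr. Qed.

Lemma repZ (a : R[i]) x v : rho (a *: x) v = a *: rho x v.
Proof. by rewrite -[a *: x]addr0 rep_lin rep0 addr0. Qed.

(* If the optimal bound [m] of [rho y] exceeded the norm of [y], then
   [m ^ 2 - y ^ 2] would be invertible by the Neumann series, while
   [m ^ 2 - rho y ^ 2] is not bounded below. *)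
Lemma rep_contractive_sa y v : star y = y -> nrm (rho y v) <= nrm y * nrm v.
Proof.
move=> ysa.
pose B := [set M : R | 0 <= M /\ forall u, nrm (rho y u) <= M * nrm u].
have Bne : B !=set0.
  have [M M0 hM] := bounded_operator_nrm _ (rep_bounded y).
  by exists M; split=> //; exact: ltW.
have B0 : has_lbound B by exists 0 => M [].
set m := inf B.
have mB u : nrm (rho y u) <= m * nrm u.
  have [u0|u0] := eqVneq u 0; first by rewrite u0 (op0 (rep_bounded y)) !nrm0 mulr0.
  have up : 0 < nrm u.
    by rewrite lt_def nrm_ge0 andbT; apply: contraNneq u0 => /nrm_eq0 ->.
  rewrite -ler_pdivrMr //; apply: lb_le_inf => // M [_ hM].
  by rewrite ler_pdivrMr.
suff le_my : m <= nrm y by apply: le_trans (mB v) _; rewrite ler_wpM2r ?nrm_ge0.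
rewrite leNgt; apply/negP => ym.
have m0 : 0 < m by exact: le_lt_trans (nrm_ge0 _) ym.
pose c : R := m ^- 2; have c0 : 0 < c by rewrite invr_gt0 exprn_gt0.
have cm : c * m ^+ 2 = 1 by rewrite mulVf // gt_eqF // exprn_gt0.
pose w := c%:C%C *: (y ∙ y).
have w1 : nrm w < 1.
  rewrite nrmZ nrm_real gtr0_norm //.
  apply: le_lt_trans (ler_wpM2l (ltW c0) (nrm_cmul _ _)) _.
  by rewrite -cm ltr_pM2l // -expr2 ltr_pXn2r // nnegrE ?nrm_ge0 // ltW.
have [z zw] := neumann_left_inverse _ w1.
have [K' K'0 hK'] := bounded_operator_nrm _ (rep_bounded z).
(* Enlarging the bound of [rho z] beyond 1 puts [1 - K ^- 2] strictly between 0 and 1. *)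
pose K := K' + 1; have K1 : 1 < K by rewrite /K; lra.
have K0 : 0 < K by lra.
have K2 : 0 < K ^- 2 < 1.
  by rewrite invr_gt0 exprn_gt0 //= invf_lt1 ?exprn_gt0 // exprn_egt1.
(* Since [rho z] is a left inverse of [rho (𝟙 - w)], the vector [d = rho (𝟙 - w) u] has norm at
   least [nrm u / K]. Its squared norm is at most [nrm u ^+ 2 - c * s ^+ 2], so the bound [m]
   improves by a fixed factor. *)
have key u : nrm (rho y u) ^+ 2 <= m ^+ 2 * (1 - K ^- 2) * nrm u ^+ 2.
  set s := nrm (rho y u).
  pose d := u - c%:C%C *: rho y (rho y u).
  have ud : nrm u <= K * nrm d.
    have {1}-> : u = rho z d.
      by rewrite -[LHS]rep1 -zw rep_mul repB rep1 /w repZ rep_mul.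
    by apply: le_trans (hK' _) _; rewrite ler_wpM2r ?nrm_ge0 // /K; lra.
  have dE : nrm d ^+ 2 = nrm u ^+ 2 - 2 * c * s ^+ 2 + c ^+ 2 * nrm (rho y (rho y u)) ^+ 2.
    apply: complexI; rewrite -ip_nrm /d ipBl !ipBr !ipZl !ipZr.
    rewrite (_ : (c%:C%C)^* = c%:C%C); last exact: conjc_real.
    rewrite [ip u (rho y _)]rep_adjr ysa [ip (rho y (rho y u)) u]rep_adj ysa !ip_nrm -/s.
    rewrite (_ : 2 * c * s ^+ 2 = c * s ^+ 2 + c * s ^+ 2); last by ring.
    rewrite !(rmorphD, rmorphB, rmorphN, rmorphM, rmorphXn) /=.
    by ring.
  (* The bound [m], applied to the vector [rho y u], lets the last term of [dE] cancel half of the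
     cross term. *)
  have t2 : nrm (rho y (rho y u)) ^+ 2 <= m ^+ 2 * s ^+ 2.
    by rewrite -exprMn ler_sqr ?mB // nnegrE ?nrm_ge0 // mulr_ge0 ?nrm_ge0 // ltW.
  have d2 : nrm d ^+ 2 <= nrm u ^+ 2 - c * s ^+ 2.
    have : c ^+ 2 * nrm (rho y (rho y u)) ^+ 2 <= c * s ^+ 2.
      have -> : c * s ^+ 2 = c ^+ 2 * (m ^+ 2 * s ^+ 2).
        by rewrite -{1}[c]mulr1 -cm; ring.
      by rewrite ler_wpM2l // exprn_ge0 // ltW.
    by rewrite dE; lra.
  have ud2 : K ^- 2 * nrm u ^+ 2 <= nrm d ^+ 2.
    rewrite mulrC ler_pdivrMr ?exprn_gt0 // mulrC -exprMn ler_sqr //.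
      by rewrite nnegrE nrm_ge0.
    by rewrite nnegrE mulr_ge0 ?nrm_ge0 // ltW.
  have : c * s ^+ 2 <= (1 - K ^- 2) * nrm u ^+ 2 by lra.
  by rewrite mulrC /c ler_pdivrMr ?exprn_gt0 //; lra.
have [K2a K2b] := andP K2.
pose q := Num.sqrt (1 - K ^- 2).
have q0 : 0 <= q by exact: sqrtr_ge0.
have q2 : q ^+ 2 = 1 - K ^- 2 by rewrite sqr_sqrtr // subr_ge0 ltW.
have q1 : q < 1.
  by rewrite -(ltr_pXn2r (n := 2)) ?nnegrE // expr1n q2; lra.
(* By [key], [m * q] is again a bound of [rho y], so it cannot be below the infimum [m]. *)
have : m <= m * q.
  apply: ge_inf => //; split; first by rewrite mulr_ge0 // ltW.
  move=> u; rewrite -ler_sqr ?nnegrE ?nrm_ge0 //; last first.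
    by rewrite !mulr_ge0 ?nrm_ge0 // ltW.
  by rewrite !exprMn q2.
by rewrite -{1}[m]mulr1 ler_pM2l //; lra.
Qed.

(** The squared norm of [rho x v] is the expectation of the self-adjoint [star x ∙ x] at [v]; the
    C*-identity turns its norm into the square of [nrm x]. *)
Lemma rep_contractive x v : nrm (rho x v) <= nrm x * nrm v.
Proof.
rewrite -ler_sqr ?nnegrE ?mulr_ge0 ?nrm_ge0 //.
have -> : nrm (rho x v) ^+ 2 = nrm (ip v (rho (star x ∙ x) v)).
  by rewrite rep_mul -rep_adj ip_nrm nrm_real ger0_norm ?sqr_ge0.
apply: le_trans (cauchy_schwarz _ _) _.
have ysa : star (star x ∙ x) = star x ∙ x by rewrite star_cmul starK.
apply: le_trans (ler_wpM2l (nrm_ge0 _) (rep_contractive_sa _ _ ysa)) _.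
by rewrite nrm_star_cmul exprMn mulrCA expr2 -expr2.
Qed.

End Representation.

(** * Density arguments *)

Section Approximation.
Context {R : realType} {H : hilbertType R}.
Implicit Types (D : set H) (u v w : H).

Definition adherent D : set H :=
  [set v | forall e : R, 0 < e -> exists2 d, D d & nrm (v - d) < e].

Lemma sub_adherent D : D `<=` adherent D.
Proof. by move=> v Dv e e0; exists v => //; rewrite subrr nrm0. Qed.

Lemma adherent_idem D : adherent (adherent D) `<=` adherent D.
Proof.
move=> v vD e e0; have e20 : 0 < e / 2 by rewrite divr_gt0.
have [u uD vu] := vD _ e20; have [d Dd ud] := uD _ e20.
exists d => //; have := nrmB_trans u v d; lra.
Qed.

Lemma adherent_op D (X : H -> H) v : bounded_operator X ->
  (forall d, D d -> adherent D (X d)) -> adherent D v -> adherent D (X v).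
Proof.
move=> bX DX Dv; have [M M0 hM] := bounded_operator_nrm _ bX.
apply: adherent_idem => e e0.
have [|d Dd vd] := Dv (e / M); first by rewrite divr_gt0.
exists (X d); first exact: DX.
by rewrite -(opB bX) (le_lt_trans (hM _)) // mulrC -ltr_pdivlMr.
Qed.

Lemma adherent_lin D (a : R[i]) u v :
  (forall x y, D x -> D y -> D (a *: x + y)) ->
  adherent D u -> adherent D v -> adherent D (a *: u + v).
Proof.
move=> Dlin Du Dv e e0; set M := nrm a + 1.
have M0 : 0 < M by rewrite ltr_wpDl ?nrm_ge0.
have [|x Dx ux] := Du (e / 2 / M); first by rewrite !divr_gt0.
have [|y Dy vy] := Dv (e / 2); first by rewrite divr_gt0.
exists (a *: x + y); first exact: Dlin.
rewrite opprD addrACA -scalerBr; apply: le_lt_trans (nrmD _ _) _.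
rewrite ltr_pdivlMr // mulrC in ux.
have : nrm (a *: (u - x)) <= M * nrm (u - x).
  by rewrite nrmZ ler_wpM2r ?nrm_ge0 // /M; lra.
by lra.
Qed.

(** Restricting to [e <= 1] lets callers absorb quadratic errors into a linear one. *)
Lemma nrm_le_lin (V : normedZmodType R[i]) (z : V) (C : R) :
  (forall e : R, 0 < e -> e <= 1 -> nrm z <= C * e) -> z = 0.
Proof.
move=> zC; apply: nrm_le_eps => e e0.
set d := Num.min 1 (e / (`|C| + 1)).
have C1 : 0 < `|C| + 1 by rewrite ltr_wpDl.
have d0 : 0 < d by rewrite lt_min ltr01 divr_gt0.
have d1 : d <= 1 by rewrite ge_min lexx.
apply: le_trans (zC _ d0 d1) _.
have : d <= e / (`|C| + 1) by rewrite ge_min lexx orbT.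
rewrite ler_pdivlMr //; have : C * d <= `|C| * d by rewrite ler_pM2r // ler_norm.
by lra.
Qed.

(** The condition [e <= 1] bounds [nrm u0] by [nrm u + 1], which keeps the error linear in [e] with
    a constant independent of the approximants. *)
Lemma ip_approx u v u0 v0 (e : R) :
  nrm (u - u0) < e -> nrm (v - v0) < e -> e <= 1 ->
  nrm (ip u v - ip u0 v0) <= (nrm u + nrm v + 1) * e.
Proof.
move=> uu0 vv0 e1.
have -> : ip u v - ip u0 v0 = ip (u - u0) v + ip u0 (v - v0).
  by rewrite ipBl ipBr addrA subrK.
apply: le_trans (nrmD _ _) _.
have := cauchy_schwarz (u - u0) v; have := cauchy_schwarz u0 (v - v0).
have u0u : nrm u0 <= nrm u + 1.
  by have := nrmD u (u0 - u); rewrite addrC subrK nrm_sub; lra.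
have h1 : nrm (u - u0) * nrm v <= e * nrm v by rewrite ler_wpM2r ?nrm_ge0 // ltW.
have h2 : nrm u0 * nrm (v - v0) <= (nrm u + 1) * e.
  by apply: ler_pM; rewrite ?nrm_ge0 // ltW.
by lra.
Qed.

Lemma bounded_operator_id : bounded_operator (id : H -> H).
Proof. by apply: (@bounded_operator_intro _ _ _ 1) => // x; rewrite mul1r. Qed.

(** Allowing different vectors and operators on the two sides covers the comparison of [ip w (X v)]
    with [ip w' v], where [Y] is [id]. *)
Lemma dense_ip_eq D (X Y : H -> H) w w' :
  (forall v, adherent D v) -> bounded_operator X -> bounded_operator Y ->
  (forall d, D d -> ip w (X d) = ip w' (Y d)) ->
  forall v, ip w (X v) = ip w' (Y v).
Proof.
move=> dD bX bY XY v; apply/eqP; rewrite -subr_eq0; apply/eqP.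
have [M M0 hM] := bounded_operator_nrm _ bX.
have [N N0 hN] := bounded_operator_nrm _ bY.
apply: (@nrm_le_lin _ _ (nrm w * M + nrm w' * N)) => e e0 _.
have [d Dd vd] := dD v e e0.
have -> : ip w (X v) - ip w' (Y v) = ip w (X (v - d)) - ip w' (Y (v - d)).
  by rewrite (opB bX) (opB bY) !ipBr (XY _ Dd) opprB addrA subrK.
apply: le_trans (nrmD _ _) _; rewrite nrmN mulrDl.
apply: lerD; apply: le_trans (cauchy_schwarz _ _) _; rewrite -mulrA;
  rewrite ler_wpM2l ?nrm_ge0 //.
- by apply: le_trans (hM _) _; rewrite ler_pM2l // ltW.
- by apply: le_trans (hN _) _; rewrite ler_pM2l // ltW.
Qed.

Lemma dense_op_eq D (X Y : H -> H) :
  (forall v, adherent D v) -> bounded_operator X -> bounded_operator Y ->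
  (forall d, D d -> X d = Y d) -> X = Y.
Proof.
move=> dD bX bY XY; apply/funext => v; apply: ip_eqP => z.
rewrite ip_conj [RHS]ip_conj; congr (_^*).
by apply: dense_ip_eq v => // d /XY ->.
Qed.

Lemma dense_separates D u v :
  (forall x, adherent D x) -> (forall d, D d -> ip d u = ip d v) -> u = v.
Proof.
move=> dD uv; apply: ip_eqP => z.
apply: (@dense_ip_eq D id id) => //; try exact: bounded_operator_id.
by move=> d /uv duv; rewrite ip_conj duv -ip_conj.
Qed.

End Approximation.

(** * From generators to the generated C*-algebra *)

Section GeneratedCommutants.
Context {R : realType} {A : cstarAlgType R} {H : hilbertType R}.
Context {rho : A -> H -> H} (hrho : representation rho).
Context {S : set A} (genS : cstar_generated S = setT).

(** Contractivity makes [rho x v] continuous in [x], so invariance of a closed subspace passes to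
    norm limits. *)
Lemma invariant_generated (E : set H) :
  (forall (a : R[i]) u v, E u -> E v -> E (a *: u + v)) ->
  adherent E `<=` E ->
  (forall s v, S s -> E v -> E (rho s v) /\ E (rho (star s) v)) ->
  forall x v, E v -> E (rho x v).
Proof.
move=> Elin Ecl ES x v Ev; move: x (I : [set: A] x) v Ev; rewrite -genS.
apply: cstar_generated_ind => [v Ev|a x y Ex Ey v Ev|x y Ex Ey v Ev|x Ex v Ev|s Ss].
- by rewrite (rep1 hrho).
- by rewrite (rep_lin hrho); apply: Elin; [apply: Ex | apply: Ey].
- by rewrite (rep_mul hrho); apply/Ex/Ey.
- apply: Ecl => e e0; have M0 : 0 < nrm v + 1 by rewrite ltr_wpDl ?nrm_ge0.
  have [|y Ey xy] := Ex (e / (nrm v + 1)); first by rewrite divr_gt0.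
  exists (rho y v); first exact: Ey.
  rewrite -(repB hrho); apply: le_lt_trans (rep_contractive hrho _ _) _.
  rewrite ltr_pdivlMr // in xy; apply: le_lt_trans xy.
  by rewrite ler_wpM2l ?nrm_ge0 //; lra.
by split=> v Ev; have [] := ES s v Ss Ev.
Qed.

Lemma commute_generated (X : H -> H) : bounded_operator X ->
  (forall s v, S s -> X (rho s v) = rho s (X v) /\
                      X (rho (star s) v) = rho (star s) (X v)) ->
  forall x v, X (rho x v) = rho x (X v).
Proof.
move=> bX XS x; move: x (I : [set: A] x); rewrite -genS.
apply: cstar_generated_ind => [v|a x y Xx Xy v|x y Xx Xy v|x Xx v|s Ss].
- by rewrite !(rep1 hrho).
- by rewrite !(rep_lin hrho) (opD bX) (opZ bX) Xx Xy.
- by rewrite !(rep_mul hrho) Xx Xy.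
- have [M M0 hM] := bounded_operator_nrm _ bX.
  apply/eqP; rewrite -subr_eq0; apply/eqP.
  apply: (@nrm_le_lin _ _ _ (M * nrm v + nrm (X v))) => e e0 _.
  have [y Xy xy] := Xx e e0.
  have -> : X (rho x v) - rho x (X v) = X (rho (x - y) v) - rho (x - y) (X v).
    by rewrite !(repB hrho) (opB bX) Xy opprB addrA subrK.
  apply: le_trans (nrmD _ _) _; rewrite nrmN mulrDl.
  apply: lerD.
    apply: le_trans (hM _) _; rewrite -mulrA ler_pM2l //.
    apply: le_trans (rep_contractive hrho _ _) _.
    by rewrite mulrC ler_wpM2l ?nrm_ge0 // ltW.
  apply: le_trans (rep_contractive hrho _ _) _.
  by rewrite mulrC ler_wpM2l ?nrm_ge0 // ltW.
by split=> v; have [] := XS s v Ss.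
Qed.

End GeneratedCommutants.

(** * Modular conjugation of commuting representations *)

Section Mirror.
Context {R : realType} {A B : cstarAlgType R} {H : hilbertType R}.
Context {l : A -> H -> H} {r : B -> H -> H} {Omega : H}.
Context (hl : representation l) (hr : representation r).
Context (lrC : forall x y v, l x (r y v) = r y (l x v)).

(** The condition on adjoints makes the relation stable under [star] and is what yields the trace
    property of [Omega]. *)
Definition mirror (x : A) (y : B) : Prop :=
  l x Omega = r y Omega /\ l (star x) Omega = r (star y) Omega.

Definition mirrored : set H := [set v | exists x y, mirror x y /\ v = l x Omega].

Lemma mirror_star x y : mirror x y -> mirror (star x) (star y).
Proof. by case=> xy xy'; split; rewrite ?starK. Qed.

Lemma mirror1 : mirror 𝟙 𝟙.
Proof. by split; rewrite ?star1 (rep1 hl) (rep1 hr). Qed.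

Lemma mirror_lin (a : R[i]) x y x' y' :
  mirror x y -> mirror x' y' -> mirror (a *: x + x') (a *: y + y').
Proof.
move=> [h1 h2] [h1' h2']; split; rewrite ?star_antilinear (rep_lin hl) (rep_lin hr).
  by rewrite h1 h1'.
by rewrite h2 h2'.
Qed.

Lemma mirrorZ (a : R[i]) x y : mirror x y -> mirror (a *: x) (a *: y).
Proof.
by move=> [h1 h2]; split; rewrite ?starZ (repZ hl) (repZ hr) ?h1 ?h2.
Qed.

(** The order is reversed because [l x (r y' Omega) = r y' (l x Omega)]: the operator acting first
    on the left is moved outermost on the right. *)
Lemma mirror_mul x y x' y' : mirror x y -> mirror x' y' -> mirror (x ∙ x') (y' ∙ y).
Proof.
move=> [h1 h2] [h1' h2']; split; rewrite ?star_cmul (rep_mul hl) (rep_mul hr).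
  by rewrite h1' lrC h1.
by rewrite h2 lrC h2'.
Qed.

(** Solve the eigenvector equation for [l x Omega] by applying the inverse of [r z], and for
    [r z Omega] by applying that of [l x]; the second case uses that [c] has modulus one. *)
Lemma mirror_eigen x z (c : R[i]) : unitary x -> unitary z -> c * c^* = 1 ->
  l x (r z Omega) = c *: Omega -> mirror x (c *: star z).
Proof.
move=> [ux _] [uz _] cc xz; split.
  rewrite (repZ hr) -(opZ (rep_bounded hr _)) -xz lrC -(rep_mul hr).
  by rewrite uz (rep1 hr).
rewrite starZ starK (repZ hr).
have -> : r z Omega = l (star x) (c *: Omega).
  by rewrite -xz -(rep_mul hl) ux (rep1 hl).
by rewrite (opZ (rep_bounded hl _)) scalerA mulrC cc scale1r.
Qed.

Lemma mirrored_lin (a : R[i]) u v :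
  mirrored u -> mirrored v -> mirrored (a *: u + v).
Proof.
move=> [x [y [xy ->]]] [x' [y' [xy' ->]]].
exists (a *: x + x'), (a *: y + y'); split; first exact: mirror_lin.
by rewrite (rep_lin hl).
Qed.

Lemma mirrored_l x y v : mirror x y -> mirrored v -> mirrored (l x v).
Proof.
move=> xy [x' [y' [xy' ->]]]; exists (x ∙ x'), (y' ∙ y).
by split; [exact: mirror_mul | rewrite (rep_mul hl)].
Qed.

(** Acting by [r y] on [l x' Omega] amounts to multiplying [x'] by [x] on the right. *)
Lemma mirrored_r x y v : mirror x y -> mirrored v -> mirrored (r y v).
Proof.
move=> xy [x' [y' [xy' ->]]]; exists (x' ∙ x), (y ∙ y').
split; first exact: mirror_mul.
by rewrite -lrC (rep_mul hl) xy.1.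
Qed.

(* This is the trace property [<Omega, x c Omega> = <Omega, c x Omega>]. *)
Lemma mirror_ip x y c : mirror x y ->
  ip (l (star x) Omega) (l c Omega) = ip (l (star c) Omega) (l x Omega).
Proof.
move=> [xy xy']; rewrite xy' (rep_adj hr) starK -lrC -xy.
by rewrite (rep_adjr hl).
Qed.

(** The trace property with [c := star x]: the map [x Omega |-> x^* Omega] is isometric. *)
Lemma mirror_nrm x y : mirror x y -> nrm (l (star x) Omega) = nrm (l x Omega).
Proof.
move=> xy; apply/eqP; rewrite -(eqrXn2 (n := 2)) ?nrm_ge0 //; apply/eqP/complexI.
by rewrite -!ip_nrm (mirror_ip _ _ _ xy) starK.
Qed.

Context (mdense : forall v, adherent mirrored v).

(** The closure of the graph of [x Omega |-> x^* Omega]; as a relation, it does not presuppose that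
    this map is well defined. *)
Definition conj_graph (u u' : H) : Prop :=
  forall e : R, 0 < e -> exists x y,
    [/\ mirror x y, nrm (u - l x Omega) < e & nrm (u' - l (star x) Omega) < e].

Lemma conj_graph_mirror x y : mirror x y -> conj_graph (l x Omega) (l (star x) Omega).
Proof. by move=> xy e e0; exists x, y; rewrite !subrr !nrm0. Qed.

Lemma conj_graph_sym u u' : conj_graph u u' -> conj_graph u' u.
Proof.
move=> uu' e e0; have [x [y [xy ux u'x]]] := uu' e e0.
by exists (star x), (star y); split; rewrite ?starK //; exact: mirror_star.
Qed.

(** Approximants of [u] within [e] differ by at most [2 * e], and by [mirror_nrm] so do their
    images, which therefore converge. *)
Lemma conj_graph_total u : exists u', conj_graph u u'.
Proof.
pose F (e : R) := [set u' | exists x y,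
  [/\ mirror x y, nrm (u - l x Omega) <= e & u' = l (star x) Omega]].
have [e e0|e e' ee' u' [x [y [xy ux ->]]]|e e0 v w|u' Fu'] := @shrinking_limit _ H F 2.
- have [_ [x [y [xy ->]]] ux] := mdense u e e0.
  by exists (l (star x) Omega), x, y; split=> //; exact: ltW.
- by exists x, y; split=> //; exact: le_trans ee'.
- move=> [x [y [xy ux ->]]] [x' [y' [xy' ux' ->]]].
  rewrite -(repB hl) -starB.
  have xx' : mirror (x - x') (y - y').
    by rewrite [x - x']addrC [y - y']addrC -(scaleN1r x') -(scaleN1r y'); apply: mirror_lin.
  rewrite (mirror_nrm _ _ xx') (repB hl).
  apply: le_trans (nrmB_trans u _ _) _; rewrite nrm_sub; lra.
exists u' => e e0; have e20 : 0 < e / 2 by rewrite divr_gt0.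
have [_ [x [y [xy ux ->]]] u'x] := Fu' _ e20.
exists x, y; split=> //; first lra.
by rewrite nrm_sub; lra.
Qed.

(** The trace property in the limit. It also shows that the relation is single-valued, since [u'] is
    determined by its inner products. *)
Lemma conj_graph_ip u u' v v' :
  conj_graph u u' -> conj_graph v v' -> ip u' v = ip v' u.
Proof.
move=> uu' vv'; apply/eqP; rewrite -subr_eq0; apply/eqP.
apply: (@nrm_le_lin _ _ _ ((nrm u' + nrm v + 1) + (nrm v' + nrm u + 1))) => e e0 e1.
have [x [y [xy ux u'x]]] := uu' e e0; have [c [d [cd vc v'c]]] := vv' e e0.
have h1 := ip_approx _ _ _ _ _ u'x vc e1.
have h2 := ip_approx _ _ _ _ _ v'c ux e1.
rewrite (mirror_ip _ _ _ xy) in h1.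
apply: le_trans (nrmB_trans (ip (l (star c) Omega) (l x Omega)) _ _) _.
by rewrite mulrDl; apply: lerD => //; rewrite nrm_sub.
Qed.

Lemma modular_conjugation : exists J : H -> H,
  [/\ forall u v, ip (J u) v = ip (J v) u,
      involutive J
    & forall x y, mirror x y -> J (l x Omega) = l (star x) Omega].
Proof.
have [J Jgr] := choice conj_graph_total.
have fun_gr u v w : conj_graph u v -> conj_graph u w -> v = w.
  move=> uv uw; apply: ip_eqP => z.
  by rewrite (conj_graph_ip _ _ _ _ uv (Jgr z)) (conj_graph_ip _ _ _ _ uw (Jgr z)).
exists J; split=> [u v|u|x y xy]; first exact: conj_graph_ip.
  by apply: fun_gr (Jgr _) _; exact: conj_graph_sym.
by apply: fun_gr (Jgr _) _; exact: conj_graph_mirror xy.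
Qed.

Section Conjugation.
Context {J : H -> H} (J_ip : forall u v, ip (J u) v = ip (J v) u).
Context (JK : involutive J).
Context (J_mirror : forall x y, mirror x y -> J (l x Omega) = l (star x) Omega).

(** Forced by the symmetry [J_ip] alone, just as an operator with an adjoint is linear. *)
Lemma J_antilinear (a : R[i]) u v : J (a *: u + v) = a^* *: J u + J v.
Proof.
apply: ip_eqP => z.
by rewrite J_ip ipDr ipZr ipDl ipZl conjCK ![ip (J z) _]J_ip.
Qed.

Lemma J_nrm u : nrm (J u) = nrm u.
Proof.
apply/eqP; rewrite -(eqrXn2 (n := 2)) ?nrm_ge0 //; apply/eqP/complexI.
by rewrite -!ip_nrm J_ip JK.
Qed.

Lemma J_cyclic : J Omega = Omega.
Proof. by have := J_mirror _ _ mirror1; rewrite star1 (rep1 hl). Qed.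

(** That is, [J (l x) J = r (star y)]. On a vector [l x' Omega] both sides give
    [l (star x') (l (star x) Omega)], by the mirror relation and commutation of the factors. *)
Lemma J_l x y v : mirror x y -> J (l x v) = r (star y) (J v).
Proof.
move=> xy; apply: ip_eqP => w.
rewrite J_ip (rep_adj hr) starK [RHS]J_ip.
apply: (@dense_ip_eq _ _ mirrored (l x) id _ _ mdense) v => //;
  [exact: rep_bounded | exact: bounded_operator_id |].
move=> _ [x' [y' [xy' ->]]]; rewrite -(rep_mul hl) J_ip [RHS]J_ip.
rewrite (J_mirror _ _ (mirror_mul _ _ _ _ xy xy')) (J_mirror _ _ xy').
by rewrite star_cmul (rep_mul hl) xy.2 lrC (rep_adj hr) starK.
Qed.

Lemma J_r x y v : mirror x y -> J (r (star y) v) = l x (J v).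
Proof. by move=> xy; rewrite -{1}[v]JK -(J_l _ _ _ xy) JK. Qed.

(** For [v = l x Omega], commutation moves [l x] past [X], and its adjoint then turns [Omega] into
    [l (star x) Omega = J v]. *)
Lemma commute_l_cyclic (X : H -> H) : bounded_operator X ->
  (forall x v, X (l x v) = l x (X v)) ->
  forall v, ip Omega (X v) = ip (J v) (X Omega).
Proof.
move=> bX Xl v; rewrite J_ip.
apply: (@dense_ip_eq _ _ mirrored X id _ _ mdense) v => //; first exact: bounded_operator_id.
move=> _ [x [y [xy ->]]]; rewrite J_ip (J_mirror _ _ xy) Xl (rep_adjr hl) //.
Qed.

(** As for the left factor, with [r y] in place of [l x]: the mirror relation identifies both [v]
    and [J v]. *)
Lemma commute_r_cyclic (X : H -> H) : bounded_operator X ->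
  (forall y v, X (r y v) = r y (X v)) ->
  forall v, ip Omega (X v) = ip (J v) (X Omega).
Proof.
move=> bX Xr v; rewrite J_ip.
apply: (@dense_ip_eq _ _ mirrored X id _ _ mdense) v => //; first exact: bounded_operator_id.
move=> _ [x [y [xy ->]]]; rewrite J_ip (J_mirror _ _ xy) xy.1 Xr (rep_adjr hr).
by rewrite xy.2.
Qed.

Lemma commutants_commute (X Y : H -> H) :
  bounded_operator X -> (forall x v, X (l x v) = l x (X v)) ->
  bounded_operator Y -> (forall y v, Y (r y v) = r y (Y v)) ->
  X \o Y = Y \o X.
Proof.
move=> bX Xl bY Yr.
(* The two cyclic identities give [<Omega, X1 Y1 Omega> = <J Y1 Omega, X1 Omega>] and [<Omega, Y1 X1
   Omega> = <J X1 Omega, Y1 Omega>], which agree by [J_ip]. *)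
have XYcyc (X1 Y1 : H -> H) :
    bounded_operator X1 -> (forall x v, X1 (l x v) = l x (X1 v)) ->
    bounded_operator Y1 -> (forall y v, Y1 (r y v) = r y (Y1 v)) ->
    ip Omega (X1 (Y1 Omega)) = ip Omega (Y1 (X1 Omega)).
  move=> bX1 X1l bY1 Y1r.
  by rewrite (commute_l_cyclic _ bX1 X1l) (commute_r_cyclic _ bY1 Y1r) J_ip.
apply: (dense_op_eq _ _ _ mdense); try exact: bounded_operator_comp.
(* A matrix element between mirrored vectors becomes an expectation at [Omega]: [r y] is absorbed
   into [X] and [l (star c)] into [Y], which preserves the commutation hypotheses. *)
move=> _ [x [y [xy ->]]] /=; apply: (dense_separates _ _ _ mdense) => _ [c [d [cd ->]]].
rewrite !(rep_adj hl) xy.1 Yr -Xl.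
have := XYcyc (X \o r y) (l (star c) \o Y).
rewrite /= -!lrC => -> //.
- exact: bounded_operator_comp bX (rep_bounded hr _).
- by move=> z v /=; rewrite -lrC Xl.
- exact: bounded_operator_comp (rep_bounded hl _) bY.
- by move=> z v /=; rewrite Yr lrC.
Qed.

End Conjugation.
End Mirror.

(** * Commutants and doubles *)

Section CommutantAndDoubles.
Context {R : realType} {A B : cstarAlgType R} {H : hilbertType R}.
Context {l : A -> H -> H} {r : B -> H -> H} {Omega : H}.
Context (hl : representation l) (hr : representation r).
Context (lrC : forall x y v, l x (r y v) = r y (l x v)).
Context (mdense : forall v, adherent (@mirrored R A B H l r Omega) v).
Context {S : set A} (genS : cstar_generated S = setT).
Context (mirrorS : forall s, S s -> exists y, @mirror R A B H l r Omega s y).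

Let L : set (H -> H) := [set l a | a in [set: A]].
Let M : set (H -> H) := [set r b | b in [set: B]].

Lemma commutant_image (C : cstarAlgType R) (rho : C -> H -> H) (X : H -> H) :
  commutant [set rho c | c in [set: C]] X <->
  bounded_operator X /\ forall c v, X (rho c v) = rho c (X v).
Proof.
split=> [[bX cX]|[bX cX]]; split=> //.
  by move=> c; apply/funeqP; apply: (cX (rho c)); exists c.
by move=> _ [c _ <-]; apply/funext => v; exact: cX.
Qed.

(** One inclusion is [commutants_commute]; for the other, [M] lies in the commutant of [L], which
    equals its own bicommutant. *)
Lemma commutant_l_eq_bicommutant_r : commutant L = bicommutant M.
Proof.
have bL X : L X -> bounded_operator X by move=> [x _ <-]; exact: rep_bounded.
have [J [J_ip JK J_mirror]] := modular_conjugation hl hr lrC mdense.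
apply/seteqP; split=> X.
  move=> /commutant_image [bX Xl]; split=> // Y /commutant_image [bY Yr].
  exact: (commutants_commute hl hr lrC mdense J_ip J_mirror).
rewrite -(commutant_bicommutant _ bL); apply: commutant_ge; apply: commutant_ge.
move=> _ [y _ <-]; apply/commutant_image; split; first exact: rep_bounded.
by move=> x v; rewrite lrC.
Qed.

(** A vector cyclic for [L] is separating for the commutant of [L]. *)
Lemma mirrored_separates (X Y : H -> H) :
  commutant L X -> commutant L Y -> X Omega = Y Omega -> X = Y.
Proof.
move=> /commutant_image [bX Xl] /commutant_image [bY Yl] XY.
by apply: (dense_op_eq _ _ _ mdense) => // _ [x [y [_ ->]]]; rewrite Xl Yl XY.
Qed.

Lemma exists_unique_double (X : H -> H) : bicommutant L X -> self_adjoint X ->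
  exists! X', is_double (bicommutant L) (vector_state Omega) X X'.
Proof.
move=> NX Xsa.
have bL Y : L Y -> bounded_operator Y by move=> [x _ <-]; exact: rep_bounded.
have [J [J_ip JK J_mirror]] := modular_conjugation hl hr lrC mdense.
have bX : bounded_operator X := NX.1.
have Xr y v : X (r y v) = r y (X v).
  have /funeqP : X \o r y = r y \o X.
    apply: NX.2; apply/commutant_image; split; first exact: rep_bounded.
    by move=> x w; rewrite lrC.
  by apply.
pose X' := J \o X \o J.
have JD u v : J (u + v) = J u + J v.
  by have := J_antilinear J_ip 1 u v; rewrite rmorph1 !scale1r.
have bX' : bounded_operator X'.
  have [m m0 hm] := bounded_operator_nrm _ bX.
  apply: (@bounded_operator_intro _ _ _ m) => [a u v|u].
    rewrite /X' /= (J_antilinear J_ip) (opD bX) (opZ bX) (J_antilinear J_ip).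
    by rewrite conjCK.
  by rewrite /X' /= (J_nrm J_ip JK) -[nrm u in leRHS](J_nrm J_ip JK).
(* Conjugation by [J] carries [l x] to [r (star y)], with which [X] commutes. This needs a mirror of
   [x]; [commute_generated] then reaches all of [A] from the generators. *)
have X'l_mirror x y v : @mirror R A B H l r Omega x y -> X' (l x v) = l x (X' v).
  move=> xy; rewrite /X' /= (J_l hl hr lrC mdense J_ip J_mirror _ _ _ xy) Xr.
  by rewrite (J_r hl hr lrC mdense J_ip JK J_mirror _ _ _ xy).
have cX' : commutant L X'.
  apply/commutant_image; split=> //.
  apply: (commute_generated hl genS _ bX') => s v /mirrorS [y sy].
  by split; apply: X'l_mirror; [exact: sy | exact: mirror_star sy].
have X'sa : self_adjoint X'.
  by move=> u v; rewrite /X' /= J_ip -Xsa [LHS]ip_conj [RHS]ip_conj (J_ip _ u).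
have JO : J Omega = Omega := J_cyclic hl hr J_mirror.
(* [<J X Omega, v> = <J v, X Omega> = <Omega, X v> = <X Omega, v>], the last equality by
   self-adjointness. *)
have X'O : X' Omega = X Omega.
  apply: ip_eqP => v; rewrite /X' /= JO J_ip.
  by rewrite -(commute_r_cyclic hr mdense J_ip J_mirror _ bX Xr) Xsa.
exists X'; split.
  split=> //; first by rewrite commutant_bicommutant.
  by rewrite /vector_state /= X'O subrr (op0 bX) (op0 bX') subrr ip0r.
(* For self-adjoint [X] and [Y] the double condition says that [(X - Y) Omega] has norm 0, so [Y]
   agrees with [X'] on the separating vector [Omega]. *)
move=> Y [cY Ysa]; rewrite commutant_bicommutant // in cY => Y0.
apply: mirrored_separates => //; rewrite X'O.
apply/eqP; rewrite -subr_eq0; apply/eqP/nrm_eq0/eqP.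
rewrite -sqrf_eq0; apply/eqP/complexI; rewrite -ip_nrm -[RHS]Y0 /vector_state /=.
by rewrite [in LHS]ipBl Xsa Ysa -ipBr.
Qed.

End CommutantAndDoubles.

(** * Correlations of the EPR state and the theorem *)

Section UnitaryEigenvector.
Context {R : realType} {T : cstarAlgType R} {H : hilbertType R}.
Context {rho : T -> H -> H} (hrho : representation rho).

(** The equality case of Cauchy-Schwarz: the squared norm of [rho u Omega - c *: Omega] expands to
    [1 - 1 - 1 + 1]. *)
Lemma unitary_eigenvector (u : T) (Omega : H) (c : R[i]) :
  unitary u -> ip Omega Omega = 1 -> c * c^* = 1 -> ip Omega (rho u Omega) = c ->
  rho u Omega = c *: Omega.
Proof.
move=> [uu _] O1 cc uO; apply/eqP; rewrite -subr_eq0; apply/eqP/nrm_eq0/eqP.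
rewrite -sqrf_eq0; apply/eqP/complexI; rewrite -ip_nrm.
rewrite ipBl !ipBr !ipZl !ipZr [ip _ Omega]ip_conj uO O1.
rewrite (rep_adj hrho) -(rep_mul hrho) uu (rep1 hrho) O1.
by rewrite mulr1 [_^* * c]mulrC cc !subrr.
Qed.

End UnitaryEigenvector.

Lemma expi_mul_conj (R : realType) (x : R) : expi x * (expi x)^* = 1.
Proof. by rewrite -normCK normE -rmorphXn /= /nrm normc_def /= cos2Dsin2 sqrtr1 expr1n. Qed.

Theorem mainTheorem3 (R : realType)
    (A : cstarAlgType R) (W : R * R -> A) (hW : is_weyl_algebra W)
    (T : cstarAlgType R) (tens : A -> A -> T) (hT : is_spatial_tensor tens)
    (lambda mu : R) (omega : {scalar T})
    (homega : is_EPR_state W tens lambda mu omega)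
    (H : hilbertType R) (pi : T -> H -> H) (Omega : H)
    (hGNS : is_GNS omega pi Omega) :
  let N := bicommutant [set pi (tens a 𝟙) | a in [set: A]] in
  commutant N = bicommutant [set pi (tens 𝟙 a) | a in [set: A]] /\
  (forall X : H -> H, N X -> self_adjoint X ->
     exists! X' : H -> H, is_double N (vector_state Omega) X X').
Proof.
have [W_unitary W_weyl W_gen] := hW.
have [[tens_linl tens_linr tens_mul tens_star tens1] [tens_gen _]] := hT.
have [[_ omega1] omega_a omega_b] := homega.
have [hpi pi_dense omegaE] := hGNS.
have bpi := rep_bounded hpi.
pose l a := pi (tens a 𝟙); pose r a := pi (tens 𝟙 a).
have tens_lr x y : tens x y = tens x 𝟙 ∙ tens 𝟙 y by rewrite tens_mul cmul1l cmul1r.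
have hl : representation l.
  split=> [x|]; first exact: bpi.
  split=> [a x y v|x y||x u v]; rewrite /l.
  - by rewrite tens_linl (rep_lin hpi).
  - by apply/funext => v; rewrite /= -(rep_mul hpi) tens_mul cmul1l.
  - by rewrite tens1; apply/funext => v; rewrite (rep1 hpi).
  - by rewrite (rep_adj hpi) tens_star star1.
have hr : representation r.
  split=> [x|]; first exact: bpi.
  split=> [a x y v|x y||x u v]; rewrite /r.
  - by rewrite tens_linr (rep_lin hpi).
  - by apply/funext => v; rewrite /= -(rep_mul hpi) tens_mul cmul1l.
  - by rewrite tens1; apply/funext => v; rewrite (rep1 hpi).
  - by rewrite (rep_adj hpi) tens_star star1.
have lrE x y v : l x (r y v) = pi (tens x y) v.
  by rewrite /l /r -(rep_mul hpi) -tens_lr.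
have lrC x y v : l x (r y v) = r y (l x v).
  by rewrite lrE /l /r -(rep_mul hpi) tens_mul cmul1l cmul1r.
pose mir := @mirror R A A H l r Omega.
have Omega1 : ip Omega Omega = 1 by rewrite -omega1 omegaE (rep1 hpi).
have eigen u u' x : omega (tens (W u) (W u')) = expi x ->
    mir (W u) (expi x *: star (W u')) /\
    mir (expi x *: star (W u)) (W u').
  move=> omega_u.
  have [uW Wu] := W_unitary u; have [uW' Wu'] := W_unitary u'.
  have m : mir (W u) (expi x *: star (W u')).
    apply: (mirror_eigen hl hr lrC) => //; first exact: expi_mul_conj.
    rewrite lrE; apply: (unitary_eigenvector hpi) => //.
    - by split; rewrite tens_star tens_mul ?uW ?uW' ?Wu ?Wu' tens1.
    - exact: expi_mul_conj.
    - by rewrite -omega_u omegaE.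
  (* Taking adjoints in [m] and multiplying by the phase isolates [W u'] on the right. *)
  split=> //; have := mirrorZ hl hr (expi x) _ _ (mirror_star _ _ m).
  by rewrite starZ starK scalerA expi_mul_conj scale1r.
have W_prod u v w : u + v = w -> exists c : R[i], W w = c *: (W u ∙ W v).
  move=> <-; exists (expi (weyl_sigma u v))^*.
  by rewrite W_weyl scalerA mulrC expi_mul_conj scale1r.
have mirror_l u : exists y, mir (W u) y.
  (* Up to a phase, [W u] is a product of Weyl operators along the two axes, whose correlations are
     prescribed. *)
  have [|c ->] := W_prod (u.1, 0) (0, u.2) u.
    by case: u => a b; congr (_, _); rewrite /= ?addr0 ?add0r.
  eexists; apply: (mirrorZ hl hr); apply: (mirror_mul hl hr lrC).
    exact: (eigen _ _ _ (omega_a u.1)).1.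
  exact: (eigen _ _ _ (omega_b u.2)).1.
have mirror_r u : exists x, mir x (W u).
  (* The axes are taken in the opposite order because [mirror_mul] reverses products on the right;
     the sign in [omega_a (- u.1)] makes the right-hand operator [W (u.1, 0)]. *)
  have [|c ->] := W_prod (0, u.2) (u.1, 0) u.
    by case: u => a b; congr (_, _); rewrite /= ?addr0 ?add0r.
  eexists; apply: (mirrorZ hl hr); apply: (mirror_mul hl hr lrC).
    have := omega_a (- u.1); rewrite opprK => /eigen [_]; exact.
  exact: (eigen _ _ _ (omega_b u.2)).2.
(* [E] is a closed subspace containing [Omega]; invariance under [l] and [r], hence under [pi],
   makes it all of [H] by cyclicity. *)
pose E := adherent (@mirrored R A A H l r Omega).
have Elin (a : R[i]) u v : E u -> E v -> E (a *: u + v).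
  by apply: adherent_lin => u' v'; exact: mirrored_lin.
have Ecl : adherent E `<=` E by exact: adherent_idem.
have El x v : E v -> E (l x v).
  apply: (invariant_generated hl W_gen _ Elin Ecl) => _ w [u _ <-] Ew.
  have [y uy] := mirror_l u; split; apply: adherent_op Ew; try exact: bpi.
    by move=> d /(mirrored_l hl hr lrC _ _ _ uy); exact: sub_adherent.
  by move=> d /(mirrored_l hl hr lrC _ _ _ (mirror_star _ _ uy)); exact: sub_adherent.
have Er x v : E v -> E (r x v).
  apply: (invariant_generated hr W_gen _ Elin Ecl) => _ w [u _ <-] Ew.
  have [y uy] := mirror_r u; split; apply: adherent_op Ew; try exact: bpi.
    by move=> d /(mirrored_r hl hr lrC _ _ _ uy); exact: sub_adherent.
  by move=> d /(mirrored_r hl hr lrC _ _ _ (mirror_star _ _ uy)); exact: sub_adherent.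
have Epi x v : E v -> E (pi x v).
  apply: (invariant_generated hpi tens_gen _ Elin Ecl) => _ w [a _ [b _ <-]] Ew.
  by rewrite tens_star -!lrE; split; apply/El/Er.
have mdense v : E v.
  apply: Ecl => e e0.
  have clv : closure [set pi x Omega | x in [set: T]] v by rewrite pi_dense.
  have [_ [x _ <-] vx] := closure_approx _ _ _ clv _ e0.
  exists (pi x Omega) => //; apply: Epi; apply: sub_adherent.
  by exists 𝟙, 𝟙; split; [exact: mirror1 | rewrite (rep1 hl)].
have genW s : range W s -> exists y, mir s y by move=> [u _ <-].
move=> N; split; last exact: (exists_unique_double hl hr lrC mdense W_gen genW).
rewrite commutant_bicommutant; last by move=> _ [x _ <-]; exact: bpi.
exact: (commutant_l_eq_bicommutant_r hl hr lrC mdense).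
Qed.
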